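(* Let $|q|<1$ and let $(\alpha_n(a,k,q),\beta_n(a,k,q))_{n\ge0}$ be sequences depending on parameters $a,k$ and base $q$ such that $(\alpha_n(a,k,q),\beta_n(a,k,q))$, $(\alpha_n(-a,-k,q),\beta_n(-a,-k,q))$ and $(\alpha_n(a^2,k^2,q^2),\beta_n(a^2,k^2,q^2))$ are WP-Bailey pairs (the last with base $q^2$). Assume $|qa|<|z|$, that no denominator vanishes, and that all series below converge absolutely. Then \begin{multline*} \sum_{n=1}^{\infty} \frac{(1-k q^{2n})(z;q)_{n}(q;q)_{n-1}}{(1-k)( q k,q k/z;q)_{n}}\left( \frac{q a}{ z }\right )^{n} \beta_n(a,k,q) + \sum_{n=1}^{\infty} \frac{(1+k q^{2n})(z;q)_{n}(q;q)_{n-1}}{(1+k)( -q k,-q k/z;q)_{n}}\left( \frac{-q a}{ z }\right )^{n}\beta_n(-a,-k,q)\\ -2 \sum_{n=1}^{\infty} \frac{(1-k^2q^{4n})(z^2;q^2)_{n}(q^2;q^2)_{n-1}} {(1-k^2)( q^2 k^2,q^2k^2/z^2;q^2)_{n}}\left( \frac{q^2 a^2}{ z^2 }\right )^{n}\beta_n(a^2,k^2,q^2)\\ =\sum_{n=1}^{\infty}\frac{(z;q)_{n}(q;q)_{n-1}}{(q a ,q a/z;q)_n}\left (\frac{q a}{z}\right)^{n}\alpha_n(a,k,q) +\sum_{n=1}^{\infty}\frac{(z;q)_{n}(q;q)_{n-1}}{(-q a ,-q a/z;q)_n}\left (\frac{-q a}{z}\right)^{n}\alpha_n(-a,-k,q)\\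 -2\sum_{n=1}^{\infty}\frac{(z^2;q^2)_{n}(q^2;q^2)_{n-1}}{(q^2 a^2 ,q^2a^2/z^2;q^2)_n}\left (\frac{q^2a^2}{z^2}\right)^{n}\alpha_n(a^2,k^2,q^2). \end{multline*}
   Context: Notation: $(x;q)_n=(1-x)(1-xq)\cdots(1-xq^{n-1})$, $(x;q)_0=1$, $(x;q)_\infty=\prod_{j\ge0}(1-xq^j)$, and $(x_1,\dots,x_m;q)_n=(x_1;q)_n\cdots(x_m;q)_n$. A WP-Bailey pair (with parameters $a,k$ and base $q$) is a pair of sequences $(\alpha_n(a,k,q),\beta_n(a,k,q))_{n\ge0}$ with $\alpha_0=\beta_0=1$ and, for $n>0$, $$\beta_n(a,k,q)=\sum_{j=0}^{n}\frac{(k/a;q)_{n-j}(k;q)_{n+j}}{(q;q)_{n-j}(aq;q)_{n+j}}\alpha_j(a,k,q).$$ *)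

(* Defs.v *)
From Stdlib Require Import Reals.
Open Scope R_scope.

Record Cplx : Type := mkC { re : R ; im : R }.

Definition Czero : Cplx := mkC 0 0.
Definition Cone : Cplx := mkC 1 0.
Definition Cadd (x y : Cplx) : Cplx := mkC (re x + re y) (im x + im y).
Definition Copp (x : Cplx) : Cplx := mkC (- re x) (- im x).
Definition Csub (x y : Cplx) : Cplx := Cadd x (Copp y).
Definition Cmul (x y : Cplx) : Cplx :=
  mkC (re x * re y - im x * im y) (re x * im y + im x * re y).
Definition Cinv (x : Cplx) : Cplx :=
  mkC (re x / (re x * re x + im x * im x)) (- im x / (re x * re x + im x * im x)).
Definition Cdiv (x y : Cplx) : Cplx := Cmul x (Cinv y).
Definition Cnorm (x : Cplx) : R := sqrt (re x * re x + im x * im x).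
Fixpoint Cpow (x : Cplx) (n : nat) : Cplx :=
  match n with O => Cone | S m => Cmul (Cpow x m) x end.
Definition Ctwo : Cplx := Cadd Cone Cone.

Fixpoint Csum (f : nat -> Cplx) (n : nat) : Cplx :=
  match n with O => f O | S m => Cadd (Csum f m) (f (S m)) end.

Fixpoint qpoch (x q : Cplx) (n : nat) : Cplx :=
  match n with O => Cone | S m => Cmul (qpoch x q m) (Csub Cone (Cmul x (Cpow q m))) end.

Definition Ccv (u : nat -> Cplx) (l : Cplx) : Prop :=
  forall eps : R, eps > 0 -> exists N : nat, forall n : nat, (n >= N)%nat ->
    Cnorm (Csub (u n) l) < eps.

Definition Cseries1 (f : nat -> Cplx) (L : Cplx) : Prop :=
  Ccv (fun N => Csum (fun i => f (S i)) N) L.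

Definition Cabs_conv1 (f : nat -> Cplx) : Prop :=
  exists l : R, Un_cv (fun N => sum_f_R0 (fun i => Cnorm (f (S i))) N) l.

Definition WPBailey (alpha beta : Cplx -> Cplx -> Cplx -> nat -> Cplx) (a k q : Cplx) : Prop :=
  alpha a k q O = Cone /\ beta a k q O = Cone /\
  forall n : nat, (n > 0)%nat ->
    beta a k q n =
      Csum (fun j =>
        Cmul (Cdiv (Cmul (qpoch (Cdiv k a) q (n - j)) (qpoch k q (n + j)))
                   (Cmul (qpoch q q (n - j)) (qpoch (Cmul a q) q (n + j))))
             (alpha a k q j)) n.

Definition beta_term (a k q z : Cplx) (b : nat -> Cplx) (n : nat) : Cplx :=
  Cmul (Cmul
    (Cdiv (Cmul (Cmul (Csub Cone (Cmul k (Cpow q (2 * n)))) (qpoch z q n)) (qpoch q q (n - 1)))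
          (Cmul (Cmul (Csub Cone k) (qpoch (Cmul q k) q n)) (qpoch (Cdiv (Cmul q k) z) q n)))
    (Cpow (Cdiv (Cmul q a) z) n)) (b n).

Definition alpha_term (a q z : Cplx) (al : nat -> Cplx) (n : nat) : Cplx :=
  Cmul (Cmul
    (Cdiv (Cmul (qpoch z q n) (qpoch q q (n - 1)))
          (Cmul (qpoch (Cmul q a) q n) (qpoch (Cdiv (Cmul q a) z) q n)))
    (Cpow (Cdiv (Cmul q a) z) n)) (al n).

(* Main.v *)
(** Substituting the definition of [beta_n] in the beta series and summing over
    [n] first, column [j >= 1] of the Bailey matrix returns exactly the [j]-th
    term of the alpha series, while column [j = 0] returns the Lambert sum
    [sum_i l(k q^i) + l(a q^i / z) - l(k q^i / z) - l(a q^i)], [l x = x / (1 - x)].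
    These column sums are nonterminating 6phi5 series; they are evaluated by
    a WZ-type telescoping relation between the parameters [(a, k)] and
    [(a q, k q)], iterated until the parameters vanish.  The partial column sums
    converge geometrically, uniformly in [j], so the exchange of summations only
    requires the terms of the alpha series to tend to [0].  Finally
    [l x + l (- x) = 2 l (x^2)] makes the Lambert sums of the three pairs cancel. *)

Require Import Defs.
From Stdlib Require Import Reals Lra Lia.
Open Scope R_scope.

Declare Scope C_scope.
Delimit Scope C_scope with C.
Bind Scope C_scope with Cplx.
Local Notation "0" := Czero : C_scope.
Local Notation "1" := Cone : C_scope.
Local Infix "+" := Cadd : C_scope.
Local Infix "-" := Csub : C_scope.
Local Infix "*" := Cmul : C_scope.
Local Infix "/" := Cdiv : C_scope.
Local Infix "^" := Cpow : C_scope.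
Local Notation "- x" := (Copp x) : C_scope.

(** * The field of complex numbers and its modulus *)

Lemma Cplx_eq (x y : Cplx) : re x = re y -> im x = im y -> x = y.
Proof. destruct x, y; simpl; congruence. Qed.

Lemma Cplx_sqr_neq0 (x : Cplx) : x <> Czero -> re x * re x + im x * im x <> 0.
Proof.
  intros Hx H; apply Hx, Cplx_eq; simpl; nra.
Qed.

Lemma Cone_neq0 : Cone <> Czero.
Proof. intros H; injection H; lra. Qed.

Lemma Cplx_field_theory :
  field_theory Czero Cone Cadd Cmul Csub Copp Cdiv Cinv (@eq Cplx).
Proof.
  constructor; [constructor| | |];
    try (intros; apply Cplx_eq; simpl; ring); try reflexivity.
  - exact Cone_neq0.
  - intros x Hx; apply Cplx_sqr_neq0 in Hx.
    apply Cplx_eq; simpl; field; exact Hx.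
Qed.

Add Field Cplx_field : Cplx_field_theory.

Lemma Cmul_neq0 (x y : Cplx) : x <> Czero -> y <> Czero -> Cmul x y <> Czero.
Proof.
  intros Hx Hy H; apply Hy.
  transitivity (Cinv x * (x * y))%C; [field; exact Hx|].
  rewrite H; ring.
Qed.

Lemma Cmul_neq0_l (x y : Cplx) : Cmul x y <> Czero -> x <> Czero.
Proof. intros H Hx; apply H; rewrite Hx; ring. Qed.

Lemma Cmul_neq0_r (x y : Cplx) : Cmul x y <> Czero -> y <> Czero.
Proof. intros H Hx; apply H; rewrite Hx; ring. Qed.

Lemma Cnorm_ge0 (x : Cplx) : 0 <= Cnorm x.
Proof. apply sqrt_pos. Qed.

Lemma Cnorm_sqr (x : Cplx) : Cnorm x * Cnorm x = re x * re x + im x * im x.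
Proof. apply sqrt_sqrt; nra. Qed.

Lemma Cnorm_0 : Cnorm Czero = 0.
Proof.
  unfold Cnorm; simpl; replace (0 * 0 + 0 * 0) with 0 by ring; apply sqrt_0.
Qed.

Lemma Cnorm_1 : Cnorm Cone = 1.
Proof.
  unfold Cnorm; simpl; replace (1 * 1 + 0 * 0) with 1 by ring; apply sqrt_1.
Qed.

Lemma Cnorm_eq0 (x : Cplx) : Cnorm x = 0 -> x = Czero.
Proof.
  intros H; assert (E := Cnorm_sqr x); rewrite H in E.
  apply Cplx_eq; simpl; nra.
Qed.

Lemma Cnorm_pos (x : Cplx) : x <> Czero -> 0 < Cnorm x.
Proof.
  intros Hx; destruct (Cnorm_ge0 x) as [H | H]; [exact H|].
  now destruct Hx; apply Cnorm_eq0.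
Qed.

Lemma Cnorm_mul (x y : Cplx) : Cnorm (Cmul x y) = Cnorm x * Cnorm y.
Proof.
  unfold Cnorm; rewrite <- sqrt_mult by nra; f_equal; simpl; ring.
Qed.

Lemma Cnorm_opp (x : Cplx) : Cnorm (Copp x) = Cnorm x.
Proof. unfold Cnorm; f_equal; simpl; ring. Qed.

Lemma Cnorm_add (x y : Cplx) : Cnorm (Cadd x y) <= Cnorm x + Cnorm y.
Proof.
  assert (Hx := Cnorm_ge0 x); assert (Hy := Cnorm_ge0 y).
  apply Rsqr_incr_0_var; [|lra]; unfold Rsqr.
  assert (E := Cnorm_sqr x); assert (F := Cnorm_sqr y).
  rewrite Cnorm_sqr; simpl.
  (* Cauchy-Schwarz: the product of the squared moduli exceeds the square of the left side by the
     square of [re x * im y - im x * re y]. *)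
  assert (H : re x * re y + im x * im y <= Cnorm x * Cnorm y).
  { apply Rsqr_incr_0_var; [|nra]; unfold Rsqr.
    replace (Cnorm x * Cnorm y * (Cnorm x * Cnorm y))
      with ((Cnorm x * Cnorm x) * (Cnorm y * Cnorm y)) by ring.
    rewrite E, F.
    assert (D := Rle_0_sqr (re x * im y - im x * re y)); unfold Rsqr in D.
    lra. }
  nra.
Qed.

Lemma Cnorm_sub (x y : Cplx) : Cnorm (Csub x y) <= Cnorm x + Cnorm y.
Proof. unfold Csub; rewrite <- (Cnorm_opp y); apply Cnorm_add. Qed.

Lemma Cnorm_sub_ge (x y : Cplx) : Cnorm x - Cnorm y <= Cnorm (Csub x y).
Proof.
  assert (H := Cnorm_add (x - y)%C y).
  replace (x - y + y)%C with x in H by ring; lra.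
Qed.

Lemma Cnorm_inv (x : Cplx) : x <> Czero -> Cnorm (Cinv x) = / Cnorm x.
Proof.
  intros Hx; apply (Rmult_eq_reg_l (Cnorm x)).
  - rewrite Rinv_r by (apply Rgt_not_eq, Cnorm_pos, Hx).
    rewrite <- Cnorm_mul, <- Cnorm_1; f_equal; field; exact Hx.
  - apply Rgt_not_eq, Cnorm_pos, Hx.
Qed.

Lemma Cnorm_div (x y : Cplx) :
  y <> Czero -> Cnorm (Cdiv x y) = Cnorm x / Cnorm y.
Proof.
  intros Hy; unfold Cdiv; rewrite Cnorm_mul, Cnorm_inv by exact Hy; reflexivity.
Qed.

Lemma Cnorm_pow (x : Cplx) (n : nat) : Cnorm (Cpow x n) = Cnorm x ^ n.
Proof.
  induction n as [|n IH]; simpl; [apply Cnorm_1|].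
  rewrite Cnorm_mul, IH; ring.
Qed.

Lemma Cpow_add (x : Cplx) (m n : nat) :
  Cpow x (m + n) = Cmul (Cpow x m) (Cpow x n).
Proof. induction m as [|m IH]; simpl; [ring | rewrite IH; ring]. Qed.

Lemma Cpow_mul_base (x y : Cplx) (n : nat) :
  Cpow (Cmul x y) n = Cmul (Cpow x n) (Cpow y n).
Proof. induction n as [|n IH]; simpl; [ring | rewrite IH; ring]. Qed.

(** * Finite sums *)

Lemma Csum_ext (f g : nat -> Cplx) (n : nat) :
  (forall i, (i <= n)%nat -> f i = g i) -> Csum f n = Csum g n.
Proof.
  induction n as [|n IH]; intros H; simpl; [apply H; lia|].
  rewrite IH, H by (intros; try apply H; lia); reflexivity.
Qed.

Lemma Csum_add (f g : nat -> Cplx) (n : nat) :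
  Csum (fun i => Cadd (f i) (g i)) n = Cadd (Csum f n) (Csum g n).
Proof. induction n as [|n IH]; simpl; [|rewrite IH]; ring. Qed.

Lemma Csum_sub (f g : nat -> Cplx) (n : nat) :
  Csum (fun i => Csub (f i) (g i)) n = Csub (Csum f n) (Csum g n).
Proof. induction n as [|n IH]; simpl; [|rewrite IH]; ring. Qed.

Lemma Csum_mul_l (c : Cplx) (f : nat -> Cplx) (n : nat) :
  Csum (fun i => Cmul c (f i)) n = Cmul c (Csum f n).
Proof. induction n as [|n IH]; simpl; [|rewrite IH]; ring. Qed.

Lemma Csum_head (f : nat -> Cplx) (n : nat) :
  Csum f (S n) = Cadd (f O) (Csum (fun i => f (S i)) n).
Proof.
  induction n as [|n IH]; [reflexivity|].
  change (Csum f (S (S n))) with (Csum f (S n) + f (S (S n)))%C.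
  rewrite IH; simpl; ring.
Qed.

Lemma Csum_telescope (f : nat -> Cplx) (n : nat) :
  Csum (fun i => Csub (f (S i)) (f i)) n = Csub (f (S n)) (f O).
Proof. induction n as [|n IH]; simpl; [|rewrite IH]; ring. Qed.

(** The second argument of [f] is the offset [i - j], so that column [j] of the triangle becomes an
    initial segment of [f j]; [j <= i] keeps the subtraction exact. *)
Lemma Csum_triangle (f : nat -> nat -> Cplx) (n : nat) :
  Csum (fun i => Csum (fun j => f j (i - j)%nat) i) n =
  Csum (fun j => Csum (f j) (n - j)) n.
Proof.
  induction n as [|n IH]; [reflexivity|].
  change (Csum (fun i => Csum (fun j => f j (i - j)%nat) i) n +
          (Csum (fun j => f j (S n - j)%nat) n + f (S n) (S n - S n)%nat) =
          Csum (fun j => Csum (f j) (S n - j)) n +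
          Csum (f (S n)) (S n - S n))%C.
  rewrite IH, Nat.sub_diag.
  rewrite (Csum_ext (fun j => Csum (f j) (S n - j))
    (fun j => Csum (f j) (n - j) + f j (S n - j)%nat)%C).
  - rewrite Csum_add; simpl; ring.
  - intros i Hi; replace (S n - i)%nat with (S (n - i)) by lia; reflexivity.
Qed.

Lemma Cnorm_Csum (f : nat -> Cplx) (n : nat) :
  Cnorm (Csum f n) <= sum_f_R0 (fun i => Cnorm (f i)) n.
Proof.
  induction n as [|n IH]; simpl; [lra|].
  eapply Rle_trans; [apply Cnorm_add | lra].
Qed.

(** * Limits *)

Lemma Ccv_Un_cv (u : nat -> Cplx) (l : Cplx) :
  Ccv u l <-> Un_cv (fun n => Cnorm (Csub (u n) l)) 0.
Proof.
  unfold Ccv, Un_cv, R_dist; split; intros H eps Heps;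
    destruct (H eps Heps) as [N HN]; exists N; intros n Hn; specialize (HN n Hn).
  - rewrite Rminus_0_r, Rabs_pos_eq by apply Cnorm_ge0; exact HN.
  - rewrite Rminus_0_r, Rabs_pos_eq in HN by apply Cnorm_ge0; exact HN.
Qed.

Lemma Un_cv0_le (u v : nat -> R) :
  (forall n, 0 <= u n <= v n) -> Un_cv v 0 -> Un_cv u 0.
Proof.
  intros H Hv eps Heps; destruct (Hv eps Heps) as [N HN]; exists N.
  intros n Hn; specialize (HN n Hn); specialize (H n).
  unfold R_dist in *; rewrite Rminus_0_r in *.
  rewrite Rabs_pos_eq in * by lra; lra.
Qed.

Lemma Un_cv0_add (u v : nat -> R) :
  Un_cv u 0 -> Un_cv v 0 -> Un_cv (fun n => u n + v n) 0.
Proof.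
  intros Hu Hv; replace 0 with (0 + 0) by ring; exact (CV_plus u v 0 0 Hu Hv).
Qed.

Lemma Un_cv0_scal (c : R) (u : nat -> R) :
  Un_cv u 0 -> Un_cv (fun n => c * u n) 0.
Proof.
  intros Hu; replace 0 with (c * 0) by ring.
  apply (CV_mult (fun _ => c) u c 0); [|exact Hu].
  intros eps Heps; exists O; intros; unfold R_dist.
  rewrite Rminus_diag, Rabs_R0; exact Heps.
Qed.

Lemma Un_cv0_pow (r : R) : 0 <= r < 1 -> Un_cv (fun n => r ^ n) 0.
Proof.
  intros Hr eps Heps.
  destruct (pow_lt_1_zero r) with (y := eps) as [N HN];
    [rewrite Rabs_pos_eq; lra | exact Heps|].
  exists N; intros n Hn; unfold R_dist; rewrite Rminus_0_r; apply HN, Hn.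
Qed.

Lemma Ccv_ext (u v : nat -> Cplx) (l : Cplx) :
  (forall n, u n = v n) -> Ccv u l -> Ccv v l.
Proof.
  intros H Hu eps Heps; destruct (Hu eps Heps) as [N HN]; exists N.
  intros n Hn; rewrite <- H; apply HN, Hn.
Qed.

Lemma Ccv_const (c : Cplx) : Ccv (fun _ => c) c.
Proof.
  intros eps Heps; exists O; intros n _.
  replace (c - c)%C with Czero by ring; rewrite Cnorm_0; exact Heps.
Qed.

Lemma Ccv_add (u v : nat -> Cplx) (l m : Cplx) :
  Ccv u l -> Ccv v m -> Ccv (fun n => Cadd (u n) (v n)) (Cadd l m).
Proof.
  rewrite !Ccv_Un_cv; intros Hu Hv.
  eapply Un_cv0_le; [|exact (Un_cv0_add _ _ Hu Hv)].
  intros n; split; [apply Cnorm_ge0|]; simpl.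
  replace (u n + v n - (l + m))%C with ((u n - l) + (v n - m))%C by ring.
  apply Cnorm_add.
Qed.

Lemma Ccv_mul (u v : nat -> Cplx) (l m : Cplx) :
  Ccv u l -> Ccv v m -> Ccv (fun n => Cmul (u n) (v n)) (Cmul l m).
Proof.
  rewrite !Ccv_Un_cv; intros Hu Hv.
  assert (H := CV_mult _ _ _ _ Hu Hv); rewrite Rmult_0_l in H.
  eapply Un_cv0_le; [|exact (Un_cv0_add _ _ H (Un_cv0_add _ _
    (Un_cv0_scal (Cnorm m) _ Hu) (Un_cv0_scal (Cnorm l) _ Hv)))].
  intros n; split; [apply Cnorm_ge0|]; simpl.
  replace (u n * v n - l * m)%C
    with ((u n - l) * (v n - m) + (m * (u n - l) + l * (v n - m)))%C by ring.
  rewrite <- !Cnorm_mul.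
  eapply Rle_trans; [apply Cnorm_add|].
  apply Rplus_le_compat_l, Cnorm_add.
Qed.

Lemma Ccv_sub (u v : nat -> Cplx) (l m : Cplx) :
  Ccv u l -> Ccv v m -> Ccv (fun n => Csub (u n) (v n)) (Csub l m).
Proof.
  intros Hu Hv.
  apply Ccv_ext with (fun n => u n + (- Cone) * v n)%C; [intros; ring|].
  replace (l - m)%C with (l + (- Cone) * m)%C by ring.
  apply Ccv_add; [exact Hu|]; apply Ccv_mul; [apply Ccv_const | exact Hv].
Qed.

(** The limit one is the case of Pochhammer symbols whose argument tends to zero. Once [u n] is
    within 1/2 of one, its modulus exceeds 1/2, so the inverse is off by at most twice as much as
    [u n]. *)
Lemma Ccv_inv1 (u : nat -> Cplx) :
  (forall n, u n <> Czero) -> Ccv u Cone -> Ccv (fun n => Cinv (u n)) Cone.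
Proof.
  intros Hn0 Hu eps Heps.
  destruct (Hu (Rmin (1 / 2) (eps / 2))) as [N HN].
  { apply Rmin_glb_lt; lra. }
  exists N; intros n Hn; specialize (HN n Hn).
  assert (H1 := Rmin_l (1 / 2) (eps / 2)).
  assert (H2 := Rmin_r (1 / 2) (eps / 2)).
  assert (H3 := Cnorm_sub_ge 1%C (1 - u n)%C).
  replace (1 - (1 - u n))%C with (u n) in H3 by ring.
  rewrite Cnorm_1 in H3.
  replace (1 - u n)%C with (- (u n - 1))%C in H3 by ring.
  rewrite Cnorm_opp in H3.
  replace (Cinv (u n) - 1)%C with (- (u n - 1) / u n)%C
    by (field; apply Hn0).
  rewrite Cnorm_div, Cnorm_opp by apply Hn0.
  apply Rmult_lt_reg_r with (Cnorm (u n)); [lra|].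
  unfold Rdiv; rewrite Rmult_assoc, Rinv_l by lra.
  nra.
Qed.

Lemma Ccv_unique (u : nat -> Cplx) (l m : Cplx) : Ccv u l -> Ccv u m -> l = m.
Proof.
  intros Hl Hm.
  assert (H := Ccv_sub _ _ _ _ Hl Hm).
  rewrite Ccv_Un_cv in H.
  assert (E : Cnorm (m - l)%C = 0).
  { apply (UL_sequence (fun _ : nat => Cnorm (m - l)%C)).
    - intros eps Heps; exists O; intros; unfold R_dist.
      rewrite Rminus_diag, Rabs_R0; exact Heps.
    - eapply Un_cv0_le; [|exact H].
      intros n; split; [apply Cnorm_ge0|]; simpl.
      right; f_equal; ring. }
  apply Cnorm_eq0 in E.
  transitivity (m - (m - l))%C; [ring|rewrite E; ring].
Qed.

(** The convolution [w] obeys [w (S n) = r * w n + x (S n)]: old terms are damped geometrically and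
    late terms of [x] are small. This controls the error left by exchanging the summations. *)
Lemma Un_cv0_geometric_convolution (r : R) (x : nat -> R) :
  0 <= r < 1 -> (forall n, 0 <= x n) -> Un_cv x 0 ->
  Un_cv (fun n => sum_f_R0 (fun j => x j * r ^ (n - j)) n) 0.
Proof.
  intros Hr Hx0 Hx.
  set (w := fun n => sum_f_R0 (fun j => x j * r ^ (n - j)) n).
  assert (Hw0 : forall n, 0 <= w n).
  { intros n; apply cond_pos_sum; intros j.
    apply Rmult_le_pos; [apply Hx0 | apply pow_le; lra]. }
  assert (Hw : forall n, w (S n) = r * w n + x (S n)).
  { intros n; unfold w; rewrite scal_sum; simpl.
    rewrite Nat.sub_diag; simpl; rewrite Rmult_1_r; f_equal.
    apply sum_eq; intros i Hi.
    replace (match i with O => S n | S l => (n - l)%nat end)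
      with (S (n - i)) by (destruct i; lia).
    simpl; ring. }
  intros eps Heps.
  (* With this bound on the tail of [x], [eps / 2] is the fixed point of
     [s -> r * s + eps * (1 - r) / 2], which closes the induction below. *)
  destruct (Hx (eps * (1 - r) / 2)) as [N HN]; [nra|].
  assert (H : forall i, w (N + i)%nat <= r ^ i * w N + eps / 2 ).
  { induction i as [|i IH]; [rewrite Nat.add_0_r; simpl; lra|].
    rewrite Nat.add_succ_r, Hw; simpl.
    specialize (HN (S (N + i))%nat ltac:(lia)).
    unfold R_dist in HN; rewrite Rminus_0_r, Rabs_pos_eq in HN by apply Hx0.
    nra. }
  destruct (Un_cv0_scal (w N) _ (Un_cv0_pow r Hr) (eps / 2)) as [K HK]; [lra|].
  exists (N + K)%nat; intros n Hn.
  specialize (H (n - N)%nat).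
  specialize (HK (n - N)%nat ltac:(lia)).
  replace (N + (n - N))%nat with n in H by lia.
  unfold R_dist in *; rewrite Rminus_0_r in *.
  rewrite Rabs_pos_eq by apply Hw0.
  assert (H' := Rle_abs (w N * r ^ (n - N))).
  change (w n < eps); lra.
Qed.

Lemma sum_geometric_le (r : R) (n : nat) :
  0 <= r < 1 -> sum_f_R0 (fun i => r ^ i) n <= / (1 - r).
Proof.
  intros Hr; rewrite tech3 by lra.
  assert (H : 0 <= r ^ S n) by (apply pow_le; lra).
  unfold Rdiv; rewrite <- (Rmult_1_l (/ (1 - r))) at 2.
  apply Rmult_le_compat_r; [left; apply Rinv_0_lt_compat|]; lra.
Qed.

Lemma Ccv_norm_le (u : nat -> Cplx) (l p : Cplx) (K : R) :
  Ccv u l -> (forall n, Cnorm (Csub p (u n)) <= K) -> Cnorm (Csub p l) <= K.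
Proof.
  intros Hu H; apply le_epsilon; intros eps Heps.
  destruct (Hu eps Heps) as [N HN]; specialize (HN N (Nat.le_refl N)).
  replace (p - l)%C with ((p - u N) + (u N - l))%C by ring.
  eapply Rle_trans; [apply Cnorm_add|]; specialize (H N); lra.
Qed.

Lemma Ccv_Csum (f : nat -> nat -> Cplx) (l : nat -> Cplx) (M : nat) :
  (forall m, Ccv (f m) (l m)) ->
  Ccv (fun N => Csum (fun m => f m N) M) (Csum l M).
Proof.
  intros H; induction M as [|M IH]; simpl; [apply H | apply Ccv_add; auto].
Qed.

Lemma Ccv_terms (g : nat -> Cplx) (l : Cplx) : Ccv (Csum g) l -> Ccv g Czero.
Proof.
  intros H eps Heps; destruct (H (eps / 2)) as [N HN]; [lra|].
  exists (S N); intros [|n] Hn; [lia|].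
  assert (H1 := HN n ltac:(lia)); assert (H2 := HN (S n) ltac:(lia)).
  replace (g (S n) - 0)%C with ((Csum g (S n) - l) - (Csum g n - l))%C
    by (simpl; ring).
  eapply Rle_lt_trans; [apply Cnorm_sub | lra].
Qed.

(** Used with [p] a power [|q| ^ N]: the one factor [p] that is kept makes the bound summable in the
    shift [N] as well as in [m]. The exponent [S m] supplies that factor even at [m = 0]. *)
Lemma pow_succ_le (r p : R) (m : nat) :
  0 <= r < 1 -> 0 <= p <= 1 -> (r * p) ^ S m <= p * r ^ m.
Proof.
  intros Hr Hp; rewrite Rpow_mult_distr; simpl.
  assert (0 <= r ^ m) by (apply pow_le; lra).
  assert (0 <= p ^ m <= 1).
  { split; [apply pow_le; lra|]; rewrite <- (pow1 m); apply pow_incr; lra. }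
  replace (r * r ^ m * (p * p ^ m)) with (p * r ^ m * (r * p ^ m)) by ring.
  rewrite <- (Rmult_1_r (p * r ^ m)) at 2.
  apply Rmult_le_compat_l; nra.
Qed.

(** * Shifted factorials *)

Definition nonvanishing (q x : Cplx) : Prop := forall n, qpoch x q n <> Czero.

Lemma qpoch_add (x q : Cplx) (m n : nat) :
  qpoch x q (m + n) = Cmul (qpoch x q m) (qpoch (Cmul x (Cpow q m)) q n).
Proof.
  induction n as [|n IH]; [rewrite Nat.add_0_r; simpl; ring|].
  rewrite Nat.add_succ_r; simpl; rewrite IH, Cpow_add; ring.
Qed.

Lemma qpoch_head (x q : Cplx) (n : nat) :
  qpoch x q (S n) = ((1 - x) * qpoch (q * x) q n)%C.
Proof.
  change (S n) with (1 + n)%nat; rewrite qpoch_add; simpl.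
  replace (x * (1 * q))%C with (q * x)%C by ring; ring.
Qed.

(** The quotient form exhibits [core] at [t * q] as a rational multiple of [core] at [t]. *)
Lemma qpoch_shift (x q : Cplx) (n : nat) :
  Csub Cone x <> Czero ->
  qpoch (Cmul x q) q n =
  Cdiv (Cmul (qpoch x q n) (Csub Cone (Cmul x (Cpow q n)))) (Csub Cone x).
Proof.
  intros Hx; assert (H := qpoch_add x q 1 n).
  replace (1 + n)%nat with (S n) in H by lia; simpl in H.
  replace (x * (1 * q))%C with (x * q)%C in H by ring.
  rewrite H; field; exact Hx.
Qed.

(** At [n = 0] the truncated [n - 1] would make the right side vanish; the condition [1 <= j + m]
    further on originates here. *)
Lemma qpoch_pred (q : Cplx) (n : nat) : (1 <= n)%nat ->
  qpoch q q (S n - 1) = Cmul (qpoch q q (n - 1)) (Csub Cone (Cpow q n)).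
Proof.
  intros Hn; destruct n as [|n]; [lia|].
  replace (S (S n) - 1)%nat with (S n) by lia.
  replace (S n - 1)%nat with n by lia; simpl; f_equal; ring.
Qed.

Lemma nonvanishing_factor (q x : Cplx) (n : nat) :
  nonvanishing q x -> Csub Cone (Cmul x (Cpow q n)) <> Czero.
Proof. intros H; exact (Cmul_neq0_r _ _ (H (S n))). Qed.

Lemma nonvanishing_pow (q x : Cplx) (N : nat) :
  nonvanishing q x -> nonvanishing q (Cmul x (Cpow q N)).
Proof.
  intros H n; apply (Cmul_neq0_r (qpoch x q N)); rewrite <- qpoch_add; apply H.
Qed.

Lemma nonvanishing_succ (q x : Cplx) :
  Csub Cone x <> Czero -> nonvanishing q (Cmul q x) -> nonvanishing q x.
Proof.
  intros Hx H [|n]; [exact Cone_neq0|].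
  change (S n) with (1 + n)%nat; rewrite qpoch_add; simpl.
  replace (x * (1 * q))%C with (q * x)%C by ring.
  apply Cmul_neq0; [|apply H].
  replace (1 * (1 - x * 1))%C with (1 - x)%C by ring; exact Hx.
Qed.

Lemma nonvanishing_base (q : Cplx) : Cnorm q < 1 -> nonvanishing q q.
Proof.
  intros Hq n; induction n as [|n IH]; simpl; [exact Cone_neq0|].
  apply Cmul_neq0; [exact IH|]; intros H.
  assert (E := Cnorm_sub_ge 1%C (q * q ^ n)%C).
  rewrite H, Cnorm_0, Cnorm_1, Cnorm_mul, Cnorm_pow in E.
  assert (H0 := Cnorm_ge0 q).
  assert (0 <= Cnorm q ^ n <= 1).
  { split; [apply pow_le, H0|]; rewrite <- (pow1 n); apply pow_incr; lra. }
  nra.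
Qed.

(** Each factor is at most the exponential of [|x| |q|^n], and these exponents form a geometric
    series, whose partial sum is carried through the induction. The comparison point [x] makes the
    bound uniform for [y] in a disk. *)
Lemma qpoch_norm_le (q x y : Cplx) (n : nat) :
  Cnorm q < 1 -> Cnorm y <= Cnorm x ->
  Cnorm (qpoch y q n) <= exp (Cnorm x / (1 - Cnorm q)).
Proof.
  intros Hq Hy; assert (Hq0 := Cnorm_ge0 q).
  assert (Hx0 := Cnorm_ge0 x); assert (Hy0 := Cnorm_ge0 y).
  assert (H : Cnorm (qpoch y q n) <=
              exp (Cnorm x / (1 - Cnorm q) * (1 - Cnorm q ^ n))).
  { induction n as [|n IH].
    - simpl; rewrite Cnorm_1, Rminus_diag, Rmult_0_r, exp_0; lra.
    - simpl; rewrite Cnorm_mul.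
      replace (Cnorm x / (1 - Cnorm q) * (1 - Cnorm q * Cnorm q ^ n))
        with (Cnorm x / (1 - Cnorm q) * (1 - Cnorm q ^ n)
              + Cnorm x * Cnorm q ^ n) by (field; lra).
      rewrite exp_plus.
      apply Rmult_le_compat; try apply Cnorm_ge0; [exact IH|].
      eapply Rle_trans; [apply Cnorm_sub|].
      rewrite Cnorm_1, Cnorm_mul, Cnorm_pow.
      assert (0 <= Cnorm q ^ n) by (apply pow_le, Hq0).
      eapply Rle_trans; [|apply exp_ineq1_le].
      apply Rplus_le_compat_l, Rmult_le_compat_r; assumption. }
  eapply Rle_trans; [exact H|].
  assert (H1 : 0 <= Cnorm q ^ n) by (apply pow_le, Hq0).
  assert (H2 : 0 <= Cnorm x / (1 - Cnorm q)).
  { apply Rmult_le_pos; [exact Hx0|]; left; apply Rinv_0_lt_compat; lra. }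
  destruct (Rle_lt_or_eq_dec _ _ H2) as [H3 | <-];
    [|rewrite Rmult_0_l; lra].
  destruct (Rle_lt_or_eq_dec _ _ H1) as [H4 | <-];
    [|rewrite Rminus_0_r, Rmult_1_r; lra].
  left; apply exp_increasing; nra.
Qed.

(* Weierstrass' inequality bounds the tail product below by [1/2]. *)
Lemma qpoch_norm_ge_half (q y : Cplx) (n : nat) :
  Cnorm q < 1 -> Cnorm y <= (1 - Cnorm q) / 2 -> 1 / 2 <= Cnorm (qpoch y q n).
Proof.
  intros Hq Hy; assert (Hq0 := Cnorm_ge0 q); assert (Hy0 := Cnorm_ge0 y).
  assert (H : 1 - (1 - Cnorm q ^ n) / 2 <= Cnorm (qpoch y q n)).
  { induction n as [|n IH]; [simpl; rewrite Cnorm_1; lra|].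
    simpl; rewrite Cnorm_mul.
    assert (E := Cnorm_sub_ge 1%C (y * q ^ n)%C).
    rewrite Cnorm_1, Cnorm_mul, Cnorm_pow in E.
    assert (0 <= Cnorm q ^ n <= 1).
    { split; [apply pow_le, Hq0|]; rewrite <- (pow1 n); apply pow_incr; lra. }
    set (p := Cnorm q ^ n) in *.
    assert (1 - (1 - Cnorm q) / 2 * p <= Cnorm (1 - y * q ^ n)%C) by nra.
    assert (0 <= (1 - p) * ((1 - Cnorm q) * p)).
    { apply Rmult_le_pos; [|apply Rmult_le_pos]; lra. }
    apply Rle_trans with
      ((1 - (1 - p) / 2) * (1 - (1 - Cnorm q) / 2 * p)); [nra|].
    apply Rmult_le_compat; nra. }
  assert (0 <= Cnorm q ^ n) by (apply pow_le, Hq0); lra.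
Qed.

(** Beyond an index [J] the tail product stays above 1/2; below [J], the product of length [n]
    divides the nonzero product of length [J] with a cofactor bounded by [C]. A shifted product is
    the quotient of those of lengths [N + n] and [N], the latter again at most [C]. *)
Lemma qpoch_norm_lower (q x : Cplx) :
  Cnorm q < 1 -> nonvanishing q x ->
  exists c, 0 < c /\ forall N n, c <= Cnorm (qpoch (Cmul x (Cpow q N)) q n).
Proof.
  intros Hq Hx; assert (Hq0 := Cnorm_ge0 q); assert (Hx0 := Cnorm_ge0 x).
  set (C := exp (Cnorm x / (1 - Cnorm q))).
  assert (HC : 0 < C) by apply exp_pos.
  assert (Hup : forall N n, Cnorm (qpoch (x * q ^ N)%C q n) <= C).
  { intros N n; apply qpoch_norm_le; [exact Hq|].
    rewrite Cnorm_mul, Cnorm_pow.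
    assert (0 <= Cnorm q ^ N <= 1).
    { split; [apply pow_le, Hq0|]; rewrite <- (pow1 N); apply pow_incr; lra. }
    nra. }
  destruct (Un_cv0_scal (Cnorm x) _ (Un_cv0_pow (Cnorm q) (conj Hq0 Hq))
    ((1 - Cnorm q) / 2)) as [J HJ]; [lra|].
  specialize (HJ J (Nat.le_refl J)); unfold R_dist in HJ.
  rewrite Rminus_0_r in HJ; assert (HJ' := Rle_abs (Cnorm x * Cnorm q ^ J)).
  set (p := Cnorm (qpoch x q J)).
  assert (Hp : 0 < p) by (apply Cnorm_pos, Hx).
  assert (Hlow : forall n, Rmin (p / 2) (p / C) <= Cnorm (qpoch x q n)).
  { intros n; destruct (Nat.le_gt_cases J n) as [Hn | Hn].
    - eapply Rle_trans; [apply Rmin_l|].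
      replace n with (J + (n - J))%nat by lia.
      rewrite qpoch_add, Cnorm_mul; fold p.
      assert (E : 1 / 2 <= Cnorm (qpoch (x * q ^ J)%C q (n - J))).
      { apply qpoch_norm_ge_half; [exact Hq|].
        rewrite Cnorm_mul, Cnorm_pow; lra. }
      nra.
    - eapply Rle_trans; [apply Rmin_r|].
      assert (E : p = Cnorm (qpoch x q n) *
                      Cnorm (qpoch (x * q ^ n)%C q (J - n))).
      { unfold p; rewrite <- Cnorm_mul, <- qpoch_add; do 2 f_equal; lia. }
      specialize (Hup n (J - n)%nat).
      assert (H0 := Cnorm_ge0 (qpoch x q n)).
      apply Rmult_le_reg_r with C; [exact HC|].
      unfold Rdiv; rewrite Rmult_assoc, Rinv_l, Rmult_1_r by lra.
      rewrite E; apply Rmult_le_compat_l; assumption. }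
  set (c := Rmin (p / 2) (p / C)) in *.
  assert (Hc : 0 < c).
  { apply Rmin_glb_lt; [lra|]; apply Rdiv_lt_0_compat; assumption. }
  exists (c / C); split; [apply Rdiv_lt_0_compat; assumption|].
  intros N n; specialize (Hlow (N + n)%nat).
  rewrite qpoch_add, Cnorm_mul in Hlow.
  assert (H1 := Hup O N); simpl in H1.
  replace (x * 1)%C with x in H1 by ring.
  assert (H2 := Cnorm_ge0 (qpoch (x * q ^ N)%C q n)).
  apply Rmult_le_reg_r with C; [exact HC|].
  unfold Rdiv; rewrite Rmult_assoc, Rinv_l, Rmult_1_r by lra.
  nra.
Qed.

(** * Uniformly bounded families *)

Definition bounded {I : Type} (f : I -> Cplx) : Prop :=
  exists C, 0 <= C /\ forall i, Cnorm (f i) <= C.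

Lemma bounded_mul {I : Type} (f g : I -> Cplx) :
  bounded f -> bounded g -> bounded (fun i => Cmul (f i) (g i)).
Proof.
  intros [C [HC Hf]] [D [HD Hg]]; exists (C * D); split; [nra|].
  intros i; rewrite Cnorm_mul.
  apply Rmult_le_compat; auto using Cnorm_ge0.
Qed.

Lemma bounded_sub {I : Type} (f g : I -> Cplx) :
  bounded f -> bounded g -> bounded (fun i => Csub (f i) (g i)).
Proof.
  intros [C [HC Hf]] [D [HD Hg]]; exists (C + D); split; [lra|].
  intros i; eapply Rle_trans; [apply Cnorm_sub|].
  apply Rplus_le_compat; auto.
Qed.

Lemma bounded_const {I : Type} (c : Cplx) : bounded (fun _ : I => c).
Proof. exists (Cnorm c); split; [apply Cnorm_ge0 | intros; lra]. Qed.

Lemma bounded_pow {I : Type} (q : Cplx) (n : I -> nat) :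
  Cnorm q < 1 -> bounded (fun i => Cpow q (n i)).
Proof.
  intros Hq; exists 1; split; [lra|]; intros i; rewrite Cnorm_pow.
  rewrite <- (pow1 (n i)); apply pow_incr; split; [apply Cnorm_ge0 | lra].
Qed.

Lemma bounded_qpoch {I : Type} (q : Cplx) (y : I -> Cplx) (n : I -> nat) :
  Cnorm q < 1 -> bounded y -> bounded (fun i => qpoch (y i) q (n i)).
Proof.
  intros Hq [C [HC Hy]].
  (* [mkC C 0] is a complex number of modulus [C], serving as the comparison point of
     [qpoch_norm_le]. *)
  exists (exp (Cnorm (mkC C 0) / (1 - Cnorm q))); split; [left; apply exp_pos|].
  intros i; apply qpoch_norm_le; [exact Hq|].
  eapply Rle_trans; [apply Hy|].
  unfold Cnorm; simpl; replace (C * C + 0 * 0) with (C * C) by ring.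
  rewrite sqrt_square by exact HC; lra.
Qed.

Lemma bounded_inv_qpoch {I : Type} (q x : Cplx) (N n : I -> nat) :
  Cnorm q < 1 -> nonvanishing q x ->
  bounded (fun i => Cinv (qpoch (Cmul x (Cpow q (N i))) q (n i))).
Proof.
  intros Hq Hx; destruct (qpoch_norm_lower q x Hq Hx) as [c [Hc H]].
  exists (/ c); split; [left; apply Rinv_0_lt_compat, Hc|]; intros i.
  rewrite Cnorm_inv by (apply nonvanishing_pow, Hx).
  apply Rinv_le_contravar; [exact Hc | apply H].
Qed.

(** * Telescoping in the parameters *)

Section Telescoping.

Variables q z b : Cplx.
Hypothesis Hq : Cnorm q < 1.

(* The parameters of a WP-Bailey pair are [a = z * t] and [k = b * z * t]; the
   shift [t -> t * q] multiplies both by [q]. *)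
Definition admissible (t : Cplx) : Prop :=
  nonvanishing q (b * z * t)%C /\ nonvanishing q (q * b * t)%C /\
  nonvanishing q (q * z * t)%C /\ nonvanishing q (q * t)%C.

(* [weight t j m] is the coefficient of [alpha_j] in the beta term of index
   [j + m], divided by [alpha_weight a q z j]; unlike the alpha term it keeps the
   factor [(q; q)_(n-1)], so that [j = 0] is covered (for [1 <= m], because of the
   truncated [j + m - 1]). *)
Definition core (t : Cplx) (j m : nat) : Cplx :=
  (qpoch (z * q ^ j) q m * qpoch q q (j + m - 1) * qpoch b q m
   * qpoch (b * z * t) q (j + m + j) * qpoch (q * z * t) q j * qpoch (q * t) q j
   * (q * t) ^ m
   / (qpoch (b * z * t) q (S (j + m)) * qpoch (q * b * t) q (j + m)
      * qpoch q q m * qpoch (q * z * t) q (j + m + j)))%C.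

Definition weight (t : Cplx) (j m : nat) : Cplx :=
  ((1 - b * z * t * q ^ (2 * (j + m))) * core t j m)%C.

(** The WZ mate of [weight] for the shift [t -> t * q]. Its factor [1 - q ^ m] removes the boundary
    term at [m = 0]. *)
Definition certificate (t : Cplx) (j m : nat) : Cplx :=
  (- ((1 - q ^ m) * (1 - b * z * t * (q * t) * (q ^ m * q ^ j * q ^ j))
      / (1 - q * t)) * core t j m)%C.

Lemma admissible_pow (t : Cplx) (N : nat) :
  admissible t -> admissible (t * q ^ N)%C.
Proof.
  intros (H1 & H2 & H3 & H4); repeat split.
  - replace (b * z * (t * q ^ N))%C with (b * z * t * q ^ N)%C by ring.
    apply nonvanishing_pow, H1.
  - replace (q * b * (t * q ^ N))%C with (q * b * t * q ^ N)%C by ring.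
    apply nonvanishing_pow, H2.
  - replace (q * z * (t * q ^ N))%C with (q * z * t * q ^ N)%C by ring.
    apply nonvanishing_pow, H3.
  - replace (q * (t * q ^ N))%C with (q * t * q ^ N)%C by ring.
    apply nonvanishing_pow, H4.
Qed.

Lemma nonvanishing_sub1 (x : Cplx) : nonvanishing q x -> (1 - x)%C <> Czero.
Proof.
  intros H; assert (E := nonvanishing_factor q x 0 H); simpl in E.
  now replace (x * 1)%C with x in E by ring.
Qed.

Lemma core_succ (t : Cplx) (j m : nat) : admissible t -> (1 <= j + m)%nat ->
  core t j (S m) =
  (core t j m *
   ((1 - z * q ^ j * q ^ m) * (1 - q ^ j * q ^ m) * (1 - b * q ^ m)
    * (1 - b * z * t * (q ^ j * q ^ m * q ^ j)) * (q * t)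
    / ((1 - b * z * t * (q ^ j * q ^ m * q)) * (1 - q * b * t * (q ^ j * q ^ m))
       * (1 - q * q ^ m) * (1 - q * z * t * (q ^ j * q ^ m * q ^ j)))))%C.
Proof.
  intros (H1 & H2 & H3 & H4) Hjm; unfold core.
  assert (Hqq := nonvanishing_base q Hq).
  replace (j + S m)%nat with (S (j + m)) by lia.
  rewrite (qpoch_pred q (j + m)) by exact Hjm.
  replace (S (j + m) + j)%nat with (S (j + m + j)) by lia.
  assert (F1 := nonvanishing_factor _ _ (S (j + m)) H1).
  assert (F2 := nonvanishing_factor _ _ (j + m) H2).
  assert (F3 := nonvanishing_factor _ _ (j + m + j) H3).
  assert (F4 := nonvanishing_factor _ _ m Hqq).
  assert (N1 := H1 (S (j + m))); assert (N2 := H2 (j + m)%nat).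
  assert (N3 := H3 (j + m + j)%nat); assert (N4 := Hqq m).
  change (qpoch (b * z * t)%C q (S (S (j + m)))) with
    (qpoch (b * z * t)%C q (S (j + m)) * (1 - b * z * t * q ^ S (j + m)))%C.
  (* [P] keeps this product as one atom while the other products are unfolded by their last
     factor. *)
  set (P := qpoch (b * z * t)%C q (S (j + m))) in *.
  cbn [qpoch Cpow] in F1 |- *; rewrite !Cpow_add in *.
  field; repeat split; assumption.
Qed.

Lemma core_shift (t : Cplx) (j m : nat) : admissible t ->
  core (t * q)%C j m =
  (core t j m *
   (q ^ m * (1 - b * z * t * (q ^ j * q ^ m * q ^ j)) * (1 - q * b * t)
    * (1 - q * z * t * q ^ j) * (1 - q * t * q ^ j)
    / ((1 - b * z * t * (q ^ j * q ^ m * q)) * (1 - q * b * t * (q ^ j * q ^ m))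
       * (1 - q * z * t * (q ^ j * q ^ m * q ^ j)) * (1 - q * t))))%C.
Proof.
  intros (H1 & H2 & H3 & H4); unfold core.
  assert (Hqq := nonvanishing_base q Hq).
  assert (S1 := nonvanishing_sub1 _ H1); assert (S2 := nonvanishing_sub1 _ H2).
  assert (S3 := nonvanishing_sub1 _ H3); assert (S4 := nonvanishing_sub1 _ H4).
  replace (b * z * (t * q))%C with (b * z * t * q)%C by ring.
  replace (q * b * (t * q))%C with (q * b * t * q)%C by ring.
  replace (q * z * (t * q))%C with (q * z * t * q)%C by ring.
  replace (q * (t * q))%C with (q * t * q)%C by ring.
  rewrite (Cpow_mul_base (q * t)%C q m), !qpoch_shift by assumption.
  assert (F1 := nonvanishing_factor _ _ (S (j + m)) H1).
  assert (F2 := nonvanishing_factor _ _ (j + m) H2).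
  assert (F3 := nonvanishing_factor _ _ (j + m + j) H3).
  assert (N1 := H1 (S (j + m))); assert (N2 := H2 (j + m)%nat).
  assert (N3 := H3 (j + m + j)%nat); assert (N4 := Hqq m).
  set (P := qpoch (b * z * t)%C q (S (j + m))) in *.
  cbn [Cpow] in F1 |- *; rewrite !Cpow_add in *.
  field; repeat split; assumption.
Qed.

(** The WZ relation. All four terms are rational multiples of [core t j m], so it reduces to an
    identity of rational functions. *)
Lemma weight_shift (t : Cplx) (j m : nat) : admissible t -> (1 <= j + m)%nat ->
  (weight t j m - weight (t * q) j m =
   certificate t j (S m) - certificate t j m)%C.
Proof.
  intros Ht Hjm; unfold weight, certificate.
  rewrite core_succ, core_shift by assumption.
  destruct Ht as (H1 & H2 & H3 & H4).
  assert (Hqq := nonvanishing_base q Hq).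
  assert (F1 := nonvanishing_factor _ _ (S (j + m)) H1).
  assert (F2 := nonvanishing_factor _ _ (j + m) H2).
  assert (F3 := nonvanishing_factor _ _ (j + m + j) H3).
  assert (F4 := nonvanishing_factor _ _ m Hqq).
  assert (S4 := nonvanishing_sub1 _ H4).
  replace (2 * (j + m))%nat with ((j + m) + (j + m))%nat by lia.
  cbn [Cpow] in *; rewrite !Cpow_add in *.
  (* From here [q ^ j] and [q ^ m] are independent variables. *)
  generalize dependent (core t j m); intros.
  generalize dependent (q ^ j)%C; generalize dependent (q ^ m)%C; intros.
  field; repeat split; assumption.
Qed.


(* The degree of [core] in the argument [q * t] is the only source of decay: all
   the other factors are bounded uniformly, also under the shifts of [t]. *)
Lemma core_bounded_ratio (t : Cplx) : admissible t ->
  exists K : nat * nat * nat -> Cplx, bounded K /\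
  forall j m N, core (t * q ^ N)%C j m = (K (j, m, N) * (q * t * q ^ N) ^ m)%C.
Proof.
  intros Ht.
  (* [K] is [core] stripped of its power; the inverses and the argument [q * q ^ 0] have the shape
     treated by [bounded_inv_qpoch]. *)
  exists (fun i => let '(j, m, N) := i in
    qpoch (z * q ^ j) q m * qpoch q q (j + m - 1) * qpoch b q m
    * qpoch (b * z * t * q ^ N) q (j + m + j) * qpoch (q * z * t * q ^ N) q j
    * qpoch (q * t * q ^ N) q j
    * Cinv (qpoch (b * z * t * q ^ N) q (S (j + m)))
    * Cinv (qpoch (q * b * t * q ^ N) q (j + m))
    * Cinv (qpoch (q * q ^ 0) q m)
    * Cinv (qpoch (q * z * t * q ^ N) q (j + m + j)))%C.
  assert (Hqq := nonvanishing_base q Hq).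
  split.
  - destruct Ht as (H1 & H2 & H3 & H4).
    (* Passes from pattern matching on triples to the projections [J], [M], [L], with which the
       boundedness lemmas can be composed. *)
    assert (B : forall f g : nat * nat * nat -> Cplx,
      (forall j m N, f (j, m, N) = g (j, m, N)) -> bounded f -> bounded g).
    { intros f g E [C [HC H]]; exists C; split; [exact HC|].
      intros [[j m] N]; rewrite <- E; apply H. }
    pose (J := fun i : nat * nat * nat => fst (fst i)).
    pose (M := fun i : nat * nat * nat => snd (fst i)).
    pose (L := fun i : nat * nat * nat => snd i).
    apply B with (fun i =>
      qpoch (z * q ^ J i) q (M i) * qpoch q q (J i + M i - 1) * qpoch b q (M i)
      * qpoch (b * z * t * q ^ L i) q (J i + M i + J i)
      * qpoch (q * z * t * q ^ L i) q (J i)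
      * qpoch (q * t * q ^ L i) q (J i)
      * Cinv (qpoch (b * z * t * q ^ L i) q (S (J i + M i)))
      * Cinv (qpoch (q * b * t * q ^ L i) q (J i + M i))
      * Cinv (qpoch (q * q ^ 0) q (M i))
      * Cinv (qpoch (q * z * t * q ^ L i) q (J i + M i + J i)))%C;
      [reflexivity|].
    repeat apply bounded_mul;
      try (apply bounded_qpoch; [exact Hq|];
           try apply bounded_mul; try apply bounded_const;
           apply bounded_pow, Hq).
    + apply (bounded_inv_qpoch q (b * z * t)%C L (fun i => S (J i + M i)));
        assumption.
    + apply (bounded_inv_qpoch q (q * b * t)%C L (fun i => (J i + M i)%nat));
        assumption.
    + apply (bounded_inv_qpoch q q (fun _ => O) M); assumption.
    + apply (bounded_inv_qpoch q (q * z * t)%C L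
        (fun i => (J i + M i + J i)%nat)); assumption.
  - intros j m N.
    destruct (admissible_pow t N Ht) as (H1 & H2 & H3 & H4).
    unfold core.
    specialize (H1 (S (j + m))); specialize (H2 (j + m)%nat).
    specialize (H3 (j + m + j)%nat); specialize (Hqq m).
    replace (q * q ^ 0)%C with q by (simpl; ring).
    replace (b * z * (t * q ^ N))%C with (b * z * t * q ^ N)%C in * by ring.
    replace (q * b * (t * q ^ N))%C with (q * b * t * q ^ N)%C in * by ring.
    replace (q * z * (t * q ^ N))%C with (q * z * t * q ^ N)%C in * by ring.
    replace (q * (t * q ^ N))%C with (q * t * q ^ N)%C in * by ring.
    set (P1 := qpoch (b * z * t * q ^ N)%C q (S (j + m))) in *.
    field; repeat split; assumption.
Qed.

Lemma core_multiple_le (t : Cplx) (f : nat -> nat -> nat -> Cplx) :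
  admissible t -> bounded (fun i => f (fst (fst i)) (snd (fst i)) (snd i)) ->
  exists C, 0 <= C /\ forall j m N,
    Cnorm (f j m N * core (t * q ^ N) j m)%C
    <= C * (Cnorm (q * t)%C * Cnorm q ^ N) ^ m.
Proof.
  intros Ht [C [HC Hf]].
  destruct (core_bounded_ratio t Ht) as [K [[D [HD HK]] E]].
  exists (C * D); split; [nra|].
  intros j m N; rewrite E, !Cnorm_mul, Cnorm_pow, <- Rmult_assoc.
  rewrite (Cnorm_mul (q * t)%C), (Cnorm_pow q N), Cnorm_mul.
  apply Rmult_le_compat_r.
  - apply pow_le, Rmult_le_pos; [|apply pow_le, Cnorm_ge0].
    apply Rmult_le_pos; apply Cnorm_ge0.
  - apply Rmult_le_compat; try apply Cnorm_ge0; [apply (Hf (j, m, N)) | apply HK].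
Qed.

Lemma weight_le (t : Cplx) : admissible t ->
  exists C, 0 <= C /\ forall j m N,
    Cnorm (weight (t * q ^ N)%C j m)
    <= C * (Cnorm (q * t)%C * Cnorm q ^ N) ^ m.
Proof.
  intros Ht; unfold weight.
  apply (core_multiple_le t
    (fun j m N => 1 - b * z * (t * q ^ N) * q ^ (2 * (j + m)))%C Ht).
  apply bounded_sub; [apply bounded_const|].
  repeat apply bounded_mul; try apply bounded_const; apply bounded_pow, Hq.
Qed.

Lemma certificate_le (t : Cplx) : admissible t ->
  exists C, 0 <= C /\ forall j m N,
    Cnorm (certificate (t * q ^ N)%C j m)
    <= C * (Cnorm (q * t)%C * Cnorm q ^ N) ^ m.
Proof.
  intros Ht; unfold certificate.
  apply (core_multiple_le t (fun j m N =>
    - ((1 - q ^ m) * (1 - b * z * (t * q ^ N) * (q * (t * q ^ N))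
                          * (q ^ m * q ^ j * q ^ j))
       / (1 - q * (t * q ^ N))))%C Ht).
  (* The denominator [1 - q * (t * q ^ N)] is a shifted Pochhammer symbol of length one. *)
  destruct (bounded_inv_qpoch q (q * t)%C
    (fun i : nat * nat * nat => snd i) (fun _ => 1%nat) Hq)
    as [C [HC H]]; [apply Ht|].
  assert (B : bounded (fun i : nat * nat * nat =>
    Cinv (1 - q * (t * q ^ snd i))%C)).
  { exists C; split; [exact HC|]; intros i; specialize (H i); simpl in H.
    now replace (1 * (1 - q * t * q ^ snd i * 1))%C
      with (1 - q * (t * q ^ snd i))%C in H by ring. }
  assert (Opp : forall f : nat * nat * nat -> Cplx,
    bounded f -> bounded (fun i => - f i)%C).
  { intros f [D [HD Hf]]; exists D; split; [exact HD|].
    intros i; rewrite Cnorm_opp; apply Hf. }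
  unfold Cdiv; apply Opp.
  repeat first [exact B | apply bounded_mul | apply bounded_sub
    | apply bounded_const | apply bounded_pow, Hq].
Qed.

(** * Iterating the shift of the parameters *)

Lemma pow_norm_base_le1 (N : nat) : 0 <= Cnorm q ^ N <= 1.
Proof.
  assert (H := Cnorm_ge0 q).
  split; [apply pow_le, H|]; rewrite <- (pow1 N); apply pow_incr; lra.
Qed.

(** [weight_shift] telescopes twice: in [m] it leaves certificates at both ends of the range, and in
    the shifts of [t] it leaves weight sums at [t] and [t * q ^ S N]. The start [m0] is 1 for column
    zero and 0 for the others. *)
Lemma weight_sum_iterate (t : Cplx) (j m0 M N : nat) :
  admissible t -> (1 <= j + m0)%nat ->
  (Csum (fun i => weight t j (m0 + i)) M
   - Csum (fun i => weight (t * q ^ S N) j (m0 + i)) M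
   + Csum (fun i => certificate (t * q ^ i) j m0) N)%C
  = Csum (fun i => certificate (t * q ^ i)%C j (m0 + S M)) N.
Proof.
  intros Ht Hj.
  assert (H1 : forall n, (
    Csum (fun i => weight (t * q ^ n) j (m0 + i)) M
    - Csum (fun i => weight (t * q ^ S n) j (m0 + i)) M
    = certificate (t * q ^ n) j (m0 + S M) - certificate (t * q ^ n) j m0)%C).
  { intros n; rewrite <- Csum_sub.
    rewrite (Csum_ext _ (fun i => certificate (t * q ^ n) j (m0 + S i)
      - certificate (t * q ^ n) j (m0 + i))%C).
    - rewrite (Csum_telescope (fun i => certificate (t * q ^ n)%C j (m0 + i))).
      now rewrite Nat.add_0_r.
    - intros i _; rewrite Nat.add_succ_r, <- weight_shift;
        [|now apply admissible_pow | lia].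
      simpl; f_equal; f_equal; ring. }
  induction N as [|N IH].
  - specialize (H1 O); simpl (t * q ^ 0)%C in *.
    simpl Csum at 3 4.
    replace (t * 1)%C with t in * by ring.
    rewrite H1; ring.
  - change (Csum ?f (S N)) with (Csum f N + f (S N))%C.
    rewrite <- IH; specialize (H1 (S N)).
    match type of H1 with (?u - ?v)%C = (?x - ?y)%C =>
      assert (E : v = (u - (x - y))%C) by (rewrite <- H1; ring) end.
    rewrite E; ring.
Qed.

(** The certificates at the upper end are at most a constant times [|q| ^ i * r ^ M], where [r] is
    the modulus of [q * t]; summing over the shifts [i] costs [1 / (1 - |q|)], whatever [j], [m0]
    and [N] are. *)
Lemma weight_sum_approx (t : Cplx) : admissible t -> Cnorm (q * t)%C < 1 ->
  exists C, 0 <= C /\ forall j m0 M N, (1 <= j + m0)%nat ->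
  Cnorm (Csum (fun i => weight t j (m0 + i)) M
   - Csum (fun i => weight (t * q ^ S N) j (m0 + i)) M
   + Csum (fun i => certificate (t * q ^ i) j m0) N)%C
  <= C * Cnorm (q * t)%C ^ M.
Proof.
  intros Ht Hr; destruct (certificate_le t Ht) as [C [HC H]].
  assert (Hq0 := Cnorm_ge0 q); assert (Hr0 := Cnorm_ge0 (q * t)%C).
  set (r := Cnorm (q * t)%C) in *.
  exists (C / (1 - Cnorm q)); split.
  { apply Rmult_le_pos; [exact HC|]; left; apply Rinv_0_lt_compat; lra. }
  intros j m0 M N Hj; rewrite weight_sum_iterate by assumption.
  eapply Rle_trans; [apply Cnorm_Csum|].
  apply Rle_trans with (sum_f_R0 (fun i => Cnorm q ^ i * (C * r ^ M)) N).
  - apply sum_Rle; intros i _; eapply Rle_trans; [apply H|].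
    assert (Hp := pow_norm_base_le1 i); set (p := Cnorm q ^ i) in *.
    rewrite Nat.add_succ_r.
    assert (E := pow_succ_le r p (m0 + M) (conj Hr0 Hr) Hp).
    assert (r ^ (m0 + M) <= r ^ M).
    { rewrite pow_add.
      assert (0 <= r ^ M) by (apply pow_le; lra).
      assert (0 <= r ^ m0 <= 1).
      { split; [apply pow_le; lra|]; rewrite <- (pow1 m0); apply pow_incr; lra. }
      nra. }
    apply Rle_trans with (C * (p * r ^ M)); [|lra].
    apply Rmult_le_compat_l; [exact HC|].
    eapply Rle_trans; [exact E|]; apply Rmult_le_compat_l; lra.
  - rewrite <- scal_sum.
    assert (G := sum_geometric_le (Cnorm q) N (conj Hq0 Hq)).
    assert (0 <= C * r ^ M) by (apply Rmult_le_pos; [|apply pow_le]; lra).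
    unfold Rdiv.
    replace (C * / (1 - Cnorm q) * r ^ M) with (C * r ^ M * / (1 - Cnorm q))
      by ring.
    apply Rmult_le_compat_l; assumption.
Qed.

(** * Column zero and the Lambert sum *)

Definition lambert (x : Cplx) : Cplx := (x / (1 - x))%C.

Definition lambert4 (t : Cplx) : Cplx :=
  (lambert (q * (b * z * t)) + lambert (q * t)
   - lambert (q * b * t) - lambert (q * z * t))%C.

(** Partial fractions: at [j = 0], [m = 1] the certificate has the denominators [1 - x], [1 - b x],
    [1 - z x], [1 - b z x] with [x = q t], one for each Lambert term. *)
Lemma certificate_0_1 (t : Cplx) : admissible t ->
  certificate t 0 1 = (- lambert4 t)%C.
Proof.
  intros (H1 & H2 & H3 & H4).
  assert (Hqq := nonvanishing_base q Hq).
  assert (S2 := nonvanishing_sub1 _ H2).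
  assert (S3 := nonvanishing_sub1 _ H3); assert (S4 := nonvanishing_sub1 _ H4).
  assert (S5 := nonvanishing_sub1 _ Hqq).
  assert (S1 := nonvanishing_sub1 _ H1).
  assert (F1 := nonvanishing_factor _ _ 1 H1).
  unfold certificate, core, lambert4, lambert; simpl in *.
  replace (b * z * t * (1 * q))%C with (q * (b * z * t))%C in * by ring.
  field; repeat split; assumption.
Qed.

(** The lower certificates at [m0 = 1] make up the Lambert sum. Comparing partial sums of equal
    length avoids naming the limit of either. *)
Lemma weight_sum_0 (t : Cplx) : admissible t -> Cnorm (q * t)%C < 1 ->
  Ccv (fun M => Csum (fun i => weight t 0 (S i)) M
                - Csum (fun i => lambert4 (t * q ^ i)) M)%C Czero.
Proof.
  intros Ht Hr; destruct (weight_sum_approx t Ht Hr) as [C [HC H]].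
  destruct (weight_le t Ht) as [D [HD HW]].
  assert (Hq0 := Cnorm_ge0 q); assert (Hr0 := Cnorm_ge0 (q * t)%C).
  set (r := Cnorm (q * t)%C) in *.
  rewrite Ccv_Un_cv.
  eapply Un_cv0_le; [|exact (Un_cv0_add _ _
    (Un_cv0_scal C _ (Un_cv0_pow r (conj Hr0 Hr)))
    (Un_cv0_scal (D / (1 - r)) _ (Un_cv0_pow (Cnorm q) (conj Hq0 Hq))))].
  intros M; split; [apply Cnorm_ge0|]; simpl.
  (* Taking as many shifts as terms sends both errors to zero together: the telescoping error like
     [r ^ M], the shifted weight sum [A'] like [|q| ^ M]. *)
  specialize (H 0%nat 1%nat M M (Nat.le_refl 1)).
  rewrite (Csum_ext (fun i => certificate (t * q ^ i)%C 0 1)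
    (fun i => (- Cone) * lambert4 (t * q ^ i))%C) in H
    by (intros i _; rewrite certificate_0_1 by (now apply admissible_pow); ring).
  rewrite Csum_mul_l in H; simpl plus in H.
  set (A := Csum (fun i => weight t 0 (S i)) M) in *.
  set (L := Csum (fun i => lambert4 (t * q ^ i)%C) M) in *.
  set (A' := Csum (fun i => weight (t * q ^ S M)%C 0 (S i)) M) in *.
  replace (A - L - 0)%C with ((A - A' + - (1) * L) + A')%C by ring.
  eapply Rle_trans; [apply Cnorm_add|]; apply Rplus_le_compat; [exact H|].
  eapply Rle_trans; [apply Cnorm_Csum|].
  apply Rle_trans with (sum_f_R0 (fun i => r ^ i * (D * Cnorm q ^ M)) M).
  - apply sum_Rle; intros i _; eapply Rle_trans; [apply HW|].
    assert (Hp := pow_norm_base_le1 (S M)).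
    assert (E := pow_succ_le r (Cnorm q ^ S M) i (conj Hr0 Hr) Hp).
    assert (P := pow_norm_base_le1 M).
    assert (P' : 0 <= r ^ i) by (apply pow_le; lra).
    replace (r ^ i * (D * Cnorm q ^ M)) with (D * (Cnorm q ^ M * r ^ i)) by ring.
    apply Rmult_le_compat_l; [exact HD|].
    eapply Rle_trans; [exact E|].
    apply Rmult_le_compat_r; [exact P'|]; simpl; nra.
  - rewrite <- scal_sum.
    assert (G := sum_geometric_le r M (conj Hr0 Hr)).
    assert (P := pow_norm_base_le1 M).
    replace (D / (1 - r) * Cnorm q ^ M) with (D * Cnorm q ^ M * / (1 - r))
      by (unfold Rdiv; ring).
    apply Rmult_le_compat_l; [nra | exact G].
Qed.

(** * Columns with positive index: the limit of vanishing parameters *)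

Lemma Ccv_pow0 : Ccv (fun n => q ^ n)%C Czero.
Proof.
  rewrite Ccv_Un_cv.
  eapply Un_cv0_le; [|exact (Un_cv0_pow (Cnorm q) (conj (Cnorm_ge0 q) Hq))].
  intros n; split; [apply Cnorm_ge0|]; simpl.
  replace (q ^ n - 0)%C with (q ^ n)%C by ring; rewrite Cnorm_pow; lra.
Qed.

Lemma Ccv_qpoch (x : Cplx) (n : nat) :
  Ccv (fun N => qpoch (x * q ^ N)%C q n) Cone.
Proof.
  induction n as [|n IH]; simpl; [apply Ccv_const|].
  replace 1%C with (1 * (1 - x * 0 * q ^ n))%C at 1 by ring.
  apply Ccv_mul; [exact IH|].
  apply Ccv_sub; [apply Ccv_const|].
  apply Ccv_mul; [|apply Ccv_const].
  apply Ccv_mul; [apply Ccv_const | apply Ccv_pow0].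
Qed.

(** Every factor containing [t * q ^ N] tends to one; what remains is [(q; q)_(n-1)] with
    [n = S j]. *)
Lemma weight_cv_0 (t : Cplx) (j : nat) : admissible t ->
  Ccv (fun N => weight (t * q ^ N)%C (S j) 0) (qpoch q q j).
Proof.
  intros Ht.
  assert (B : forall x n, nonvanishing q x ->
    Ccv (fun N => Cinv (qpoch (x * q ^ N)%C q n)) Cone).
  { intros x n Hx; apply Ccv_inv1; [|apply Ccv_qpoch].
    intros N; now apply nonvanishing_pow. }
  apply Ccv_ext with (fun N =>
    (1 - b * z * t * q ^ N * q ^ (2 * (S j + 0)))
    * (qpoch q q j * qpoch (b * z * t * q ^ N) q (S j + 0 + S j)
       * qpoch (q * z * t * q ^ N) q (S j) * qpoch (q * t * q ^ N) q (S j)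
       * Cinv (qpoch (b * z * t * q ^ N) q (S (S j + 0)))
       * Cinv (qpoch (q * b * t * q ^ N) q (S j + 0))
       * Cinv (qpoch (q * z * t * q ^ N) q (S j + 0 + S j))))%C.
  - intros N; unfold weight, core.
    destruct (admissible_pow t N Ht) as (H1 & H2 & H3 & H4).
    specialize (H1 (S (S j + 0))); specialize (H2 (S j + 0)%nat).
    specialize (H3 (S j + 0 + S j)%nat).
    replace (S j + 0 - 1)%nat with j by lia.
    replace (b * z * (t * q ^ N))%C with (b * z * t * q ^ N)%C in * by ring.
    replace (q * b * (t * q ^ N))%C with (q * b * t * q ^ N)%C in * by ring.
    replace (q * z * (t * q ^ N))%C with (q * z * t * q ^ N)%C in * by ring.
    replace (q * (t * q ^ N))%C with (q * t * q ^ N)%C in * by ring.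
    set (P1 := qpoch (b * z * t * q ^ N)%C q (S (S j + 0))) in *.
    set (P2 := qpoch (b * z * t * q ^ N)%C q (S j + 0 + S j)) in *.
    set (P3 := qpoch (q * b * t * q ^ N)%C q (S j + 0)) in *.
    set (P4 := qpoch (q * z * t * q ^ N)%C q (S j + 0 + S j)) in *.
    set (P5 := qpoch (q * z * t * q ^ N)%C q (S j)).
    set (P6 := qpoch (q * t * q ^ N)%C q (S j)).
    set (Q := (q ^ (2 * (S j + 0)))%C).
    cbn [qpoch Cpow].
    field; repeat split; try assumption; exact Cone_neq0.
  - set (Q := (q ^ (2 * (S j + 0)))%C).
    (* The limit is spelled out factor by factor, in the shape that the limit lemmas build up, and
       only then simplified. *)
    assert (E : ((1 - b * z * t * 0 * Q)
      * (qpoch q q j * 1 * 1 * 1 * 1 * 1 * 1))%C = qpoch q q j) by ring.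
    refine (eq_ind _ (Ccv _) _ _ E).
    destruct Ht as (H1 & H2 & H3 & H4).
    repeat first [apply Ccv_mul | apply Ccv_sub | apply Ccv_const
      | apply Ccv_pow0 | apply Ccv_qpoch | now apply B].
Qed.

(** For positive column index the range starts at [m = 0], where the certificate vanishes, so the
    column sums at [t] and at [t * q ^ S N] differ by at most [C * r ^ M]. As [N] grows the latter
    tends to its term [m = 0] alone. Uniformity of [C] in [j] is what the exchange of summations
    requires. *)
Lemma weight_sum_S (t : Cplx) : admissible t -> Cnorm (q * t)%C < 1 ->
  exists C, 0 <= C /\ forall j M,
  Cnorm (Csum (weight t (S j)) M - qpoch q q j)%C <= C * Cnorm (q * t)%C ^ M.
Proof.
  intros Ht Hr; destruct (weight_sum_approx t Ht Hr) as [C [HC H]].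
  exists C; split; [exact HC|]; intros j M.
  (* The termwise limits in [N]: for positive [m] the bound of [weight_le] contains a positive power
     of [|q| ^ S N]. *)
  set (l := fun m => match m with O => qpoch q q j | S _ => Czero end).
  apply Ccv_norm_le with
    (fun N => Csum (fun m => weight (t * q ^ N * q)%C (S j) m) M).
  - replace (qpoch q q j) with (Csum l M).
    + apply (Ccv_Csum (fun m N => weight (t * q ^ N * q)%C (S j) m)).
      intros [|m].
      * apply Ccv_ext with (fun N => weight (t * q * q ^ N)%C (S j) 0).
        -- intros N; f_equal; ring.
        -- apply weight_cv_0.
           replace (t * q)%C with (t * q ^ 1)%C by (simpl; ring).
           now apply admissible_pow.
      * destruct (weight_le t Ht) as [D [HD HW]].
        rewrite Ccv_Un_cv.
        eapply Un_cv0_le; [|exact (Un_cv0_scal D _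
          (Un_cv0_pow (Cnorm q) (conj (Cnorm_ge0 q) Hq)))].
        intros N; split; [apply Cnorm_ge0|]; simpl.
        replace (t * q ^ N * q)%C with (t * q ^ S N)%C by (simpl; ring).
        replace (weight (t * q ^ S N) (S j) (S m) - 0)%C
          with (weight (t * q ^ S N)%C (S j) (S m)) by ring.
        eapply Rle_trans; [apply HW|]; apply Rmult_le_compat_l; [exact HD|].
        assert (Hp := pow_norm_base_le1 (S N)).
        assert (Hp' := pow_norm_base_le1 N).
        assert (Hr0 := Cnorm_ge0 (q * t)%C).
        eapply Rle_trans; [apply pow_succ_le; lra|].
        assert (0 <= Cnorm (q * t)%C ^ m <= 1).
        { split; [apply pow_le; lra|]; rewrite <- (pow1 m); apply pow_incr; lra. }
        assert (Hq0 := Cnorm_ge0 q).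
        apply Rle_trans with (Cnorm q ^ S N); [nra|]; simpl; nra.
    + clear; induction M as [|M IH]; simpl; [reflexivity|rewrite IH; ring].
  - intros N; specialize (H (S j) O M N ltac:(lia)).
    (* The zero terms are written as products so that [Csum_mul_l] extracts a zero factor from the
       sum. *)
    rewrite (Csum_ext (fun i => certificate (t * q ^ i)%C (S j) 0)
      (fun _ => Czero * 0)%C) in H
      by (intros; unfold certificate, Cdiv; simpl Cpow; ring).
    rewrite Csum_mul_l in H; simpl plus in H.
    replace (t * q ^ N * q)%C with (t * q ^ S N)%C by (simpl; ring).
    match goal with |- Cnorm (?u - ?v)%C <= _ =>
      match type of H with Cnorm (?x - ?y + ?w)%C <= _ =>
        change x with u in H; change y with v in H;
        replace (u - v + w)%C with (u - v)%C in H by ring end end.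
    exact H.
Qed.

End Telescoping.

(** * A single WP-Bailey pair *)

(** The coefficient in [alpha_term] without [(q; q)_(j-1)], which for positive [j] reappears as the
    column sum of [weight]. *)
Definition alpha_weight (a q z : Cplx) (j : nat) : Cplx :=
  (qpoch z q j * (q * a / z) ^ j
   / (qpoch (q * a) q j * qpoch (q * a / z) q j))%C.

Lemma alpha_term_succ (a q z : Cplx) (al : nat -> Cplx) (j : nat) :
  nonvanishing q (q * a)%C -> nonvanishing q (q * a / z)%C ->
  alpha_term a q z al (S j) =
  (alpha_weight a q z (S j) * al (S j) * qpoch q q j)%C.
Proof.
  intros H1 H2; unfold alpha_term, alpha_weight.
  replace (S j - 1)%nat with j by lia.
  specialize (H1 (S j)); specialize (H2 (S j)).
  set (P := qpoch (q * a)%C q (S j)) in *.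
  set (P' := qpoch (q * a / z)%C q (S j)) in *.
  field_simplify_eq; [ring|split; assumption].
Qed.

(** With [b = k / a] and [t = a / z] the arguments [k], [q k / z], [q a], [q a / z] are those of
    [core]. Putting [n = j + m], the symbol [(z; q)_n] and the power of [q a / z] split at [j], the
    first parts going to [alpha_weight]. *)
Lemma beta_term_expand (alpha beta : Cplx -> Cplx -> Cplx -> nat -> Cplx)
  (a k q z : Cplx) (n : nat) :
  Cnorm q < 1 -> WPBailey alpha beta a k q -> a <> Czero -> z <> Czero ->
  admissible q z (k / a)%C (a / z)%C -> (1 <= n)%nat ->
  beta_term a k q z (beta a k q) n =
  Csum (fun j => alpha_weight a q z j * alpha a k q j
                 * weight q z (k / a) (a / z) j (n - j))%C n.
Proof.
  intros Hq (_ & _ & Hb) Ha Hz Hadm Hn.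
  unfold beta_term; rewrite Hb by lia; rewrite <- Csum_mul_l.
  apply Csum_ext; intros j Hj.
  assert (Hqq := nonvanishing_base q Hq).
  destruct Hadm as (H1 & H2 & H3 & H4).
  unfold alpha_weight, weight, core.
  replace (k / a * z * (a / z))%C with k in * by (field; auto).
  replace (q * (k / a) * (a / z))%C with (q * k / z)%C in * by (field; auto).
  replace (q * z * (a / z))%C with (q * a)%C in * by (field; auto).
  replace (q * (a / z))%C with (q * a / z)%C in * by (field; auto).
  replace (a * q)%C with (q * a)%C by ring.
  set (m := (n - j)%nat); replace n with (j + m)%nat in * by lia.
  (* [(k; q)_(n+1)] separates into [1 - k] and [(q k; q)_n], the two denominators of [beta_term]. *)
  assert (N1 := H1 (S (j + m))); rewrite qpoch_head in *.
  assert (N2 := H2 (j + m)%nat); assert (N3 := H3 (j + m + j)%nat).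
  assert (N4 := Hqq m); assert (N5 := H3 j); assert (N6 := H4 j).
  assert (N7 := Cmul_neq0_l _ _ N1); assert (N8 := Cmul_neq0_r _ _ N1).
  rewrite (qpoch_add z q j m), (Cpow_add (q * a / z)%C j m).
  generalize dependent (q * a / z)%C; generalize dependent (q * k / z)%C; intros.
  generalize (k / a)%C; intros.
  field; repeat split; assumption.
Qed.

Definition lambert_term (a k q z : Cplx) (i : nat) : Cplx :=
  (lambert (k * q ^ S i) + lambert (a / z * q ^ S i)
   - lambert (k / z * q ^ S i) - lambert (a * q ^ S i))%C.

(** Column zero is [weight_sum_0]. Each further column misses its alpha term by [e (S j)] times
    [O(r ^ (M - j))], and the sum of these errors is the convolution of a null sequence with a
    geometric one. *)
Lemma WPBailey_lambert (alpha beta : Cplx -> Cplx -> Cplx -> nat -> Cplx)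
  (a k q z A : Cplx) :
  Cnorm q < 1 -> WPBailey alpha beta a k q ->
  Cnorm (q * a)%C < Cnorm z -> a <> Czero -> (1 - k)%C <> Czero ->
  nonvanishing q (q * k)%C -> nonvanishing q (q * k / z)%C ->
  nonvanishing q (q * a)%C -> nonvanishing q (q * a / z)%C ->
  Cseries1 (alpha_term a q z (alpha a k q)) A ->
  Ccv (fun M =>
    Csum (fun i => beta_term a k q z (beta a k q) (S i)) M
    - Csum (fun i => alpha_term a q z (alpha a k q) (S i)) M
    - Csum (lambert_term a k q z) M)%C Czero.
Proof.
  intros Hq HWP Hza Ha Hk N1 N2 N3 N4 HA.
  assert (Hz : z <> Czero).
  { intros E; rewrite E, Cnorm_0 in Hza.
    assert (H := Cnorm_ge0 (q * a)%C); lra. }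
  set (t := (a / z)%C); set (b := (k / a)%C).
  assert (Et : (q * t)%C = (q * a / z)%C) by (unfold t, Cdiv; ring).
  assert (Ek : (b * z * t)%C = k) by (unfold b, t; field; auto).
  assert (Ht : admissible q z b t).
  { repeat split.
    - rewrite Ek; now apply nonvanishing_succ.
    - replace (q * b * t)%C with (q * k / z)%C by (unfold b, t; field; auto).
      exact N2.
    - replace (q * z * t)%C with (q * a)%C by (unfold t; field; auto).
      exact N3.
    - rewrite Et; exact N4. }
  assert (Hr : Cnorm (q * t)%C < 1).
  { rewrite Et, Cnorm_div by exact Hz.
    assert (Hz0 := Cnorm_pos z Hz).
    apply Rmult_lt_reg_r with (Cnorm z); [exact Hz0|].
    unfold Rdiv; rewrite Rmult_assoc, Rinv_l by lra; lra. }
  destruct (weight_sum_S q z b Hq t Ht Hr) as [C [HC HS]].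
  assert (H0 := weight_sum_0 q z b Hq t Ht Hr).
  destruct (qpoch_norm_lower q q Hq (nonvanishing_base q Hq)) as [c [Hc Hlow]].
  set (e := fun j => (alpha_weight a q z j * alpha a k q j)%C).
  set (x := fun j => Cnorm (alpha_term a q z (alpha a k q) (S j))).
  (* The alpha term is [e (S j)] times [(q; q)_j], whose modulus is at least [c]; so the decay of
     the terms passes to [e]. *)
  assert (He : forall j, Cnorm (e (S j)) <= / c * x j).
  { intros j; unfold x; rewrite alpha_term_succ, Cnorm_mul by assumption.
    fold (e (S j)); specialize (Hlow O j); simpl in Hlow.
    replace (q * 1)%C with q in Hlow by ring.
    apply Rmult_le_reg_l with c; [exact Hc|].
    rewrite <- Rmult_assoc, Rinv_r, Rmult_1_l, Rmult_comm by lra.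
    apply Rmult_le_compat_l; [apply Cnorm_ge0 | exact Hlow]. }
  assert (Hx : Un_cv x 0).
  { apply Ccv_terms, Ccv_Un_cv in HA.
    eapply Un_cv0_le; [|exact HA].
    intros n; split; [apply Cnorm_ge0|]; right; unfold x; f_equal; ring. }
  (* Exact for every finite [M]: since [n] runs up to [S M], column [S j] is cut off at [m = M - j],
     and the last sum collects the resulting defects. *)
  assert (E : forall M,
    (Csum (fun i => beta_term a k q z (beta a k q) (S i)) M
     - Csum (fun i => alpha_term a q z (alpha a k q) (S i)) M
     - Csum (lambert_term a k q z) M
     = (Csum (fun i => weight q z b t 0 (S i)) M
        - Csum (fun i => lambert4 q z b (t * q ^ i)) M)
       + Csum (fun j => e (S j) * (Csum (weight q z b t (S j)) (M - j)
                                   - qpoch q q j)) M)%C).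
  { intros M.
    rewrite (Csum_ext (fun i => beta_term a k q z (beta a k q) (S i))
      (fun i => weight q z b t 0 (S i)
        + Csum (fun j => e (S j) * weight q z b t (S j) (i - j)) i)%C).
    (* Column zero splits off with coefficient one, because [alpha_0 = 1] and [alpha_weight] at zero
       consists of empty products. *)
    2:{ intros i _; rewrite (beta_term_expand alpha) by (assumption || lia).
        rewrite Csum_head; f_equal.
        destruct HWP as [E0 _]; rewrite E0; unfold alpha_weight; simpl.
        fold b t; field; exact Cone_neq0. }
    rewrite Csum_add.
    rewrite (Csum_triangle (fun j m => e (S j) * weight q z b t (S j) m)%C M).
    rewrite (Csum_ext (fun j => Csum (fun m => e (S j) * weight q z b t (S j) m)%C
                                     (M - j))
      (fun j => e (S j) * Csum (weight q z b t (S j)) (M - j))%C)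
      by (intros; apply Csum_mul_l).
    rewrite (Csum_ext (fun i => alpha_term a q z (alpha a k q) (S i))
      (fun j => e (S j) * qpoch q q j)%C)
      by (intros; now apply alpha_term_succ).
    rewrite (Csum_ext (lambert_term a k q z)
      (fun i => lambert4 q z b (t * q ^ i))%C).
    2:{ intros i _; unfold lambert_term, lambert4; simpl.
        f_equal; [f_equal; [f_equal|]|]; f_equal; unfold b, t; field; auto. }
    rewrite (Csum_ext (fun j => e (S j) * (Csum (weight q z b t (S j)) (M - j)
                                   - qpoch q q j))%C
      (fun j => e (S j) * Csum (weight q z b t (S j)) (M - j)
                - e (S j) * qpoch q q j)%C) by (intros; ring).
    rewrite Csum_sub; ring. }
  apply Ccv_ext with (1 := fun M => eq_sym (E M)).
  replace 0%C with (0 + 0)%C by ring.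
  apply Ccv_add; [exact H0|].
  rewrite Ccv_Un_cv.
  eapply Un_cv0_le; [|exact (Un_cv0_scal (/ c * C) _
    (Un_cv0_geometric_convolution (Cnorm (q * t)%C) x
      (conj (Cnorm_ge0 _) Hr) (fun j => Cnorm_ge0 _) Hx))].
  intros M; split; [apply Cnorm_ge0|]; simpl.
  match goal with |- Cnorm (?u - 0)%C <= _ =>
    replace (u - 0)%C with u by ring end.
  eapply Rle_trans; [apply Cnorm_Csum|].
  rewrite scal_sum; apply sum_Rle; intros j _; rewrite Cnorm_mul.
  replace (x j * Cnorm (q * t)%C ^ (M - j) * (/ c * C))
    with ((/ c * x j) * (C * Cnorm (q * t)%C ^ (M - j))) by ring.
  apply Rmult_le_compat; auto using Cnorm_ge0.
Qed.

(** * Cancellation of the Lambert sums among the three pairs *)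

Lemma lambert_add_opp (x : Cplx) : (1 - x * x)%C <> Czero ->
  (lambert x + lambert (- x) = Ctwo * lambert (x * x))%C.
Proof.
  intros H; unfold lambert, Ctwo.
  assert (H' : ((1 - x) * (1 + x))%C <> Czero)
    by (replace ((1 - x) * (1 + x))%C with (1 - x * x)%C by ring; exact H).
  assert (H1 := Cmul_neq0_l _ _ H'); assert (H2 := Cmul_neq0_r _ _ H').
  replace (1 - x * x)%C with ((1 - x) * (1 + x))%C by ring.
  replace (1 - - x)%C with (1 + x)%C by ring.
  field; split; assumption.
Qed.

Lemma lambert_term_cancel (a k q z : Cplx) (i : nat) : z <> Czero ->
  nonvanishing (q * q)%C (q * q * (k * k))%C ->
  nonvanishing (q * q)%C (q * q * (k * k) / (z * z))%C ->
  nonvanishing (q * q)%C (q * q * (a * a))%C ->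
  nonvanishing (q * q)%C (q * q * (a * a) / (z * z))%C ->
  (lambert_term a k q z i + lambert_term (- a) (- k) q z i
   = Ctwo * lambert_term (a * a) (k * k) (q * q) (z * z) i)%C.
Proof.
  intros Hz H1 H2 H3 H4.
  (* The separate [y] lets the hypotheses be used in their own form, with [(k * k) / (z * z)] where
     the argument is the square of [k / z]. *)
  assert (F : forall x y, nonvanishing (q * q)%C y ->
    y = (q * q * (x * x))%C ->
    (lambert (x * q ^ S i) + lambert (- (x * q ^ S i))
     = Ctwo * lambert (x * x * (q * q) ^ S i))%C).
  { intros x y Hy Ey; rewrite lambert_add_opp.
    - rewrite Cpow_mul_base; f_equal; f_equal; ring.
    - assert (E := nonvanishing_factor _ _ i Hy).
      rewrite Ey, Cpow_mul_base in E.
      replace (x * q ^ S i * (x * q ^ S i))%C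
        with (q * q * (x * x) * (q ^ i * q ^ i))%C by (simpl; ring).
      exact E. }
  assert (E1 := F k _ H1 eq_refl).
  assert (E2 := F (k / z)%C _ H2 ltac:(field; exact Hz)).
  assert (E3 := F a _ H3 eq_refl).
  assert (E4 := F (a / z)%C _ H4 ltac:(field; exact Hz)).
  unfold lambert_term.
  replace (- k * q ^ S i)%C with (- (k * q ^ S i))%C by ring.
  replace (- a * q ^ S i)%C with (- (a * q ^ S i))%C by ring.
  replace (- k / z * q ^ S i)%C with (- (k / z * q ^ S i))%C
    by (unfold Cdiv; ring).
  replace (- a / z * q ^ S i)%C with (- (a / z * q ^ S i))%C
    by (unfold Cdiv; ring).
  replace (k * k / (z * z))%C with (k / z * (k / z))%C by (field; exact Hz).
  replace (a * a / (z * z))%C with (a / z * (a / z))%C by (field; exact Hz).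
  transitivity
    (Ctwo * lambert (k * k * (q * q) ^ S i)
     + Ctwo * lambert (a / z * (a / z) * (q * q) ^ S i)
     - Ctwo * lambert (k / z * (k / z) * (q * q) ^ S i)
     - Ctwo * lambert (a * a * (q * q) ^ S i))%C; [|ring].
  rewrite <- E1, <- E2, <- E3, <- E4; ring.
Qed.

Theorem theorem1p2
  (alpha beta : Cplx -> Cplx -> Cplx -> nat -> Cplx) (a k q z : Cplx)
  (hq : Cnorm q < 1)
  (hWP1 : WPBailey alpha beta a k q)
  (hWP2 : WPBailey alpha beta (Copp a) (Copp k) q)
  (hWP3 : WPBailey alpha beta (Cmul a a) (Cmul k k) (Cmul q q))
  (hz : Cnorm (Cmul q a) < Cnorm z)
  (* no denominator vanishes *)
  (ha0 : a <> Czero)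
  (hk1 : Csub Cone k <> Czero) (hk2 : Cadd Cone k <> Czero) (hk3 : Csub Cone (Cmul k k) <> Czero)
  (hden : forall n : nat,
     qpoch (Cmul q k) q n <> Czero /\ qpoch (Cdiv (Cmul q k) z) q n <> Czero /\
     qpoch (Cmul q a) q n <> Czero /\ qpoch (Cdiv (Cmul q a) z) q n <> Czero /\
     qpoch (Cmul q (Copp k)) q n <> Czero /\ qpoch (Cdiv (Cmul q (Copp k)) z) q n <> Czero /\
     qpoch (Cmul q (Copp a)) q n <> Czero /\ qpoch (Cdiv (Cmul q (Copp a)) z) q n <> Czero /\
     qpoch (Cmul (Cmul q q) (Cmul k k)) (Cmul q q) n <> Czero /\
     qpoch (Cdiv (Cmul (Cmul q q) (Cmul k k)) (Cmul z z)) (Cmul q q) n <> Czero /\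
     qpoch (Cmul (Cmul q q) (Cmul a a)) (Cmul q q) n <> Czero /\
     qpoch (Cdiv (Cmul (Cmul q q) (Cmul a a)) (Cmul z z)) (Cmul q q) n <> Czero)
  (* all series converge absolutely *)
  (hc1 : Cabs_conv1 (beta_term a k q z (beta a k q)))
  (hc2 : Cabs_conv1 (beta_term (Copp a) (Copp k) q z (beta (Copp a) (Copp k) q)))
  (hc3 : Cabs_conv1 (beta_term (Cmul a a) (Cmul k k) (Cmul q q) (Cmul z z)
                       (beta (Cmul a a) (Cmul k k) (Cmul q q))))
  (hc4 : Cabs_conv1 (alpha_term a q z (alpha a k q)))
  (hc5 : Cabs_conv1 (alpha_term (Copp a) q z (alpha (Copp a) (Copp k) q)))
  (hc6 : Cabs_conv1 (alpha_term (Cmul a a) (Cmul q q) (Cmul z z)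
                       (alpha (Cmul a a) (Cmul k k) (Cmul q q))))
  (B1 B2 B3 A1 A2 A3 : Cplx)
  (hB1 : Cseries1 (beta_term a k q z (beta a k q)) B1)
  (hB2 : Cseries1 (beta_term (Copp a) (Copp k) q z (beta (Copp a) (Copp k) q)) B2)
  (hB3 : Cseries1 (beta_term (Cmul a a) (Cmul k k) (Cmul q q) (Cmul z z)
                     (beta (Cmul a a) (Cmul k k) (Cmul q q))) B3)
  (hA1 : Cseries1 (alpha_term a q z (alpha a k q)) A1)
  (hA2 : Cseries1 (alpha_term (Copp a) q z (alpha (Copp a) (Copp k) q)) A2)
  (hA3 : Cseries1 (alpha_term (Cmul a a) (Cmul q q) (Cmul z z)
                     (alpha (Cmul a a) (Cmul k k) (Cmul q q))) A3) :
  Csub (Cadd B1 B2) (Cmul Ctwo B3) = Csub (Cadd A1 A2) (Cmul Ctwo A3).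
Proof.
  assert (Hz : z <> Czero).
  { intros E; rewrite E, Cnorm_0 in hz.
    assert (H := Cnorm_ge0 (q * a)%C); lra. }
  assert (Hqq : Cnorm (q * q)%C < 1).
  { rewrite Cnorm_mul; assert (H := Cnorm_ge0 q); nra. }
  assert (D1 : Ccv _ _) by (apply (WPBailey_lambert alpha beta a k q z A1);
    first [assumption | intros n; apply (hden n)]).
  assert (D2 : Ccv _ _) by (apply (WPBailey_lambert alpha beta (- a) (- k) q z A2);
    first [assumption | intros n; apply (hden n) | idtac];
    [ replace (q * - a)%C with (- (q * a))%C by ring; now rewrite Cnorm_opp
    | intros H; apply ha0; transitivity (- - a)%C; [ring | rewrite H; ring]
    | replace (1 - - k)%C with (1 + k)%C by ring; exact hk2 ]).
  assert (D3 : Ccv _ _) by (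
    apply (WPBailey_lambert alpha beta (a * a) (k * k) (q * q) (z * z) A3);
    first [assumption | intros n; apply (hden n) | idtac];
    [ replace (q * q * (a * a))%C with (q * a * (q * a))%C by ring;
      rewrite !(Cnorm_mul (q * a)%C), Cnorm_mul; rewrite Cnorm_mul in hz |- *;
      apply Rmult_le_0_lt_compat; try exact hz;
      rewrite <- Cnorm_mul; apply Cnorm_ge0
    | now apply Cmul_neq0 ]).
  (* First pair plus second minus twice the third: [L] gives limit zero with the Lambert sums still
     present, while [R] gives the limit of the six series alone. *)
  assert (L := Ccv_sub _ _ _ _ (Ccv_add _ _ _ _ D1 D2)
    (Ccv_mul _ _ _ _ (Ccv_const Ctwo) D3)); cbv beta in L.
  unfold Cseries1 in *.
  assert (R := Ccv_sub _ _ _ _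
    (Ccv_sub _ _ _ _ (Ccv_add _ _ _ _ hB1 hB2)
      (Ccv_mul _ _ _ _ (Ccv_const Ctwo) hB3))
    (Ccv_sub _ _ _ _ (Ccv_add _ _ _ _ hA1 hA2)
      (Ccv_mul _ _ _ _ (Ccv_const Ctwo) hA3))); cbv beta in R.
  assert (E : (B1 + B2 - Ctwo * B3 - (A1 + A2 - Ctwo * A3)
               = 0 + 0 - Ctwo * 0)%C).
  { eapply Ccv_unique; [exact R|].
    eapply Ccv_ext; [|exact L]; intros M; cbv beta.
    (* The Lambert sums cancel already at each finite [M], so [L] and [R] concern the same sequence
       and uniqueness of limits applies. *)
    assert (H : (Csum (lambert_term a k q z) M
                 + Csum (lambert_term (- a) (- k) q z) M
                 = Ctwo * Csum (lambert_term (a * a) (k * k) (q * q) (z * z)) M)%C).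
    { rewrite <- Csum_add, <- Csum_mul_l; apply Csum_ext; intros i _.
      apply lambert_term_cancel; [exact Hz| | | |]; intros n; apply (hden n). }
    match type of H with (?u + ?v)%C = ?w =>
      assert (H' : v = (w - u)%C) by (rewrite <- H; ring) end.
    rewrite H'; ring. }
  match goal with |- ?u = ?v =>
    transitivity (v + (u - v))%C; [ring | rewrite E; ring] end.
Qed.
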